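(* Let $\Omega\subset\mathbb{R}^d$ be a domain, let $a_{ij},b_i,c,f:\Omega\to\mathbb{R}$ ($1\le i,j\le d$) and $g:\partial\Omega\to\mathbb{R}$ be given, with $a_{ij}=a_{ji}$, and suppose there is a constant $\theta>0$ such that $\sum_{i,j=1}^d a_{ij}(x)\xi_i\xi_j\ge\theta|\xi|^2$ for all $\xi\in\mathbb{R}^d$ and almost every $x\in\Omega$. For $u\in H^1(\Omega)$ and $\varphi\in H^1_0(\Omega)$ put $$\langle \mathcal{A}[u],\varphi\rangle := \int_\Omega\Big(\sum_{j=1}^d\sum_{i=1}^d a_{ij}\,\partial_j u\,\partial_i\varphi+\sum_{i=1}^d b_i\,\varphi\,\partial_i u+c\,u\,\varphi-f\varphi\Big)\,dx$$ and $$\|\mathcal{A}[u]\|_{op}:=\max\big\{\langle\mathcal{A}[u],\varphi\rangle/\|\varphi\|_2 \;:\; \varphi\in H^1_0(\Omega),\ \varphi\ne 0\big\},\qquad \|\varphi\|_2=\Big(\int_\Omega|\varphi(x)|^2dx\Big)^{1/2}.$$ Consider the boundary value problem $$-\sum_{i=1}^d\partial_i\Big(\sum_{j=1}^d a_{ij}\partial_j u\Big)+\sum_{i=1}^d b_i\partial_i u+cu-f=0\ \text{ in }\Omega,\qquad \mathcal{B}[u]=0\ \text{ on }\partial\Omega,$$ where $\mathcal{B}[u]=0$ is either the Dirichlet condition $u-g=0$ or the Neumann condition $\partial u/\partial\vec n-g=0$. Suppose $u^*$ satisfies the boundary condition $\mathcal{B}[u^*]=0$. Then $u^*$ is a weak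 solution of the boundary value problem if and only if $u^*$ solves the two equivalent problems $$\min_{u\in H^1(\Omega)}\|\mathcal{A}[u]\|_{op}^2\qquad\Longleftrightarrow\qquad \min_{u\in H^1(\Omega)}\ \max_{\varphi\in H^1_0(\Omega)}\ \frac{|\langle\mathcal{A}[u],\varphi\rangle|^2}{\|\varphi\|_2^2}$$ and $\|\mathcal{A}[u^*]\|_{op}=0$.
   Context: All functions are real valued. $H^1(\Omega)$ is the Sobolev space of functions which, together with their first-order weak partial derivatives, are in $L^2(\Omega)$; $H^1_0(\Omega)$ is the Hilbert space of those with vanishing trace on $\partial\Omega$. $\vec n$ is the outer normal direction on $\partial\Omega$ and $\partial u/\partial\vec n$ is the directional derivative of $u$ along $\vec n$. For fixed $u$, $\mathcal{A}[u]$ is regarded as a linear functional (operator) $\mathcal{A}[u]:H^1_0(\Omega)\to\mathbb{R}$, $\varphi\mapsto\langle\mathcal{A}[u],\varphi\rangle$, and $\|\mathcal{A}[u]\|_{op}$ is its operator norm induced from the $L^2$ norm. Weak solution: $u\in H^1(\Omega)$ (with possibly nonzero trace) is a weak solution of the boundary value problem if $\langle\mathcal{A}[u],\varphi\rangle=0$ for all $\varphi\in H^1_0(\Omega)$ and $\mathcal{B}[u]=0$ on $\partial\Omega$. *)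

(* Defs.v *)
From HB Require Import structures.
From mathcomp Require Import all_boot all_order all_algebra.
From mathcomp Require Import all_classical all_reals all_analysis.

Set Implicit Arguments.
Unset Strict Implicit.
Unset Printing Implicit Defensive.

Import Order.TTheory GRing.Theory Num.Theory.
Import numFieldNormedType.Exports.

Local Open Scope classical_set_scope.
Local Open Scope ring_scope.

(* R^d is 'rV[R]_d, with the sigma-algebra generated by the coordinates,
   i.e. the Borel sigma-algebra. *)
Definition rV_display : measure_display. Proof. by constructor. Qed.

Section measurable_rV.
Context {R : realType}.
Variable n : nat.

Let coors : 'I_n -> 'rV[R]_n -> R := fun i x => x ord0 i.

Let rV_set0 : g_sigma_preimage coors set0.
Proof. exact: sigma_algebra0. Qed.

Let rV_setC A : g_sigma_preimage coors A -> g_sigma_preimage coors (~` A).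
Proof. exact: sigma_algebraC. Qed.

Let rV_bigcup (F : _^nat) : (forall i, g_sigma_preimage coors (F i)) ->
  g_sigma_preimage coors (\bigcup_i (F i)).
Proof. exact: sigma_algebra_bigcup. Qed.

HB.instance Definition _ := @isMeasurable.Build rV_display
  'rV[R]_n (g_sigma_preimage coors) rV_set0 rV_setC rV_bigcup.

End measurable_rV.

Lemma measurable_coord (R : realType) n (i : 'I_n) :
  measurable_fun [set: 'rV[R]_n] (fun x : 'rV[R]_n => x ord0 i).
Proof.
move=> _ Y mY; rewrite setTI; apply: sub_sigma_algebra => /=.
rewrite -bigcup_seq/=; exists i => /=; first by rewrite mem_index_enum.
by exists Y => //; rewrite setTI.
Qed.

Lemma measurable_fun_rVP d (T : measurableType d) (R : realType) n
    (f : T -> 'rV[R]_n) :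
  (forall i, measurable_fun [set: T] (fun t => f t ord0 i)) ->
  measurable_fun [set: T] f.
Proof.
move=> mf; have H : g_sigma_preimage (fun i (t : T) => f t ord0 i) `<=` measurable.
  apply: smallest_sub; first exact: sigma_algebra_measurable.
  move=> A; rewrite -bigcup_seq => -[i _] [B mB <-].
  exact: mf.
move=> _ A mA; apply: H.
rewrite (@g_sigma_preimage_comp _ _ _ _ (fun i (x : 'rV[R]_n) => x ord0 i) _ f).
by exists A.
Qed.

Definition consrV (R : realType) n (p : R * 'rV[R]_n) : 'rV[R]_n.+1 :=
  row_mx (\row_(_ < 1) p.1) p.2.

Lemma measurable_consrV (R : realType) n : measurable_fun setT (@consrV R n).
Proof.
apply: measurable_fun_rVP => i; rewrite /consrV.
rewrite -[i](@fintype.splitK 1 n).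
case: (fintype.split _) => j /=.
- rewrite (_ : (fun _ => _) = fst) //; apply/funext => t.
  by rewrite (@row_mxEl _ 1 1 n) mxE.
- rewrite (_ : (fun _ => _) = (fun x : 'rV[R]_n => x ord0 j) \o snd).
    by apply: measurableT_comp => //; exact: measurable_coord.
  by apply/funext => t; rewrite (@row_mxEr _ 1 1 n).
Qed.

Section lebesgue_rV_step.
Context {R : realType} (n : nat).
Variable mu : {sigma_finite_measure set 'rV[R]_n -> \bar R}.

Definition lebesgue_rV_cons (A : set 'rV[R]_n.+1) : \bar R :=
  (@lebesgue_measure R \x mu)%E (@consrV R n @^-1` A).

Let measurable_preim (A : set 'rV[R]_n.+1) : measurable A ->
  measurable (@consrV R n @^-1` A).
Proof. by move=> mA; rewrite -[X in measurable X]setTI; exact: measurable_consrV. Qed.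

Let lebesgue_rV_cons0 : lebesgue_rV_cons set0 = 0%E.
Proof. by rewrite /lebesgue_rV_cons preimage_set0 measure0. Qed.

Let lebesgue_rV_cons_ge0 A : (0 <= lebesgue_rV_cons A)%E.
Proof. exact: measure_ge0. Qed.

Let lebesgue_rV_cons_additive : semi_sigma_additive lebesgue_rV_cons.
Proof.
move=> F mF tF mUF; rewrite /lebesgue_rV_cons preimage_bigcup.
apply: measure_semi_sigma_additive.
- by move=> k; exact: measurable_preim.
- apply/trivIsetP => /= i j _ _ ij; rewrite -preimage_setI.
  by move/trivIsetP : tF => /(_ _ _ _ _ ij) ->//; rewrite preimage_set0.
- by rewrite -preimage_bigcup; exact: measurable_preim.
Qed.

HB.instance Definition _ := isMeasure.Build _ _ _ lebesgue_rV_cons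
  lebesgue_rV_cons0 lebesgue_rV_cons_ge0 lebesgue_rV_cons_additive.

Let lebesgue_rV_cons_sigma_finite : sigma_finite setT lebesgue_rV_cons.
Proof.
have /sigma_finiteP[F [TF ndF Foo]] := sigma_finiteT (@lebesgue_measure R).
have /sigma_finiteP[G [TG ndG Goo]] := sigma_finiteT mu.
pose g (y : 'rV[R]_n.+1) : R * 'rV[R]_n :=
  (lsubmx (y : 'rV_(1 + n)) ord0 ord0, rsubmx (y : 'rV_(1 + n))).
have mg : measurable_fun setT g.
  apply/measurable_fun_pairP; split => /=.
    rewrite (_ : _ \o _ = fun y : 'rV[R]_n.+1 => (y : 'rV_(1 + n)) ord0 (lshift n (ord0 : 'I_1))).
      exact: measurable_coord.
    by apply/funext => y /=; rewrite mxE.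
  apply: measurable_fun_rVP => i.
  rewrite (_ : (fun _ => _) = fun y : 'rV[R]_n.+1 => (y : 'rV_(1 + n)) ord0 (rshift 1 i)).
    exact: measurable_coord.
  by apply/funext => y /=; rewrite mxE.
have gK p : g (consrV p) = p.
  by rewrite /g /consrV row_mxKl row_mxKr mxE; case: p.
exists (fun k => g @^-1` (F k `*` G k)).
  rewrite -preimage_bigcup -[LHS](@preimage_setT _ _ g); congr (_ @^-1` _).
  rewrite -setXTT TF TG predeqE => -[x y]; split.
    move=> [/= [m _ Fmx] [k _ Gky]]; exists (maxn m k) => //; split.
    - by move: x Fmx; exact/subsetPset/ndF/leq_maxl.
    - by move: y Gky; exact/subsetPset/ndG/leq_maxr.
  by move=> [m _ []/= ? ?]; split; exists m.
move=> k; have [mF Fk] := Foo k; have [mG Gk] := Goo k; split.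
  by rewrite -[X in measurable X]setTI; apply: mg => //; exact: measurableX.
rewrite /lebesgue_rV_cons (_ : _ @^-1` _ = F k `*` G k); last first.
  by rewrite -comp_preimage (_ : g \o _ = id)//; apply/funext => p; exact: gK.
by rewrite product_measure1E// lte_mul_pinfty// ge0_fin_numE.
Qed.

HB.instance Definition _ := Measure_isSigmaFinite.Build _ _ _ lebesgue_rV_cons
  lebesgue_rV_cons_sigma_finite.

End lebesgue_rV_step.

Fixpoint lebesgue_rV (R : realType) n
    : {sigma_finite_measure set 'rV[R]_n -> \bar R} :=
  match n with
  | 0 => dirac (0 : 'rV[R]_0)
  | m.+1 => lebesgue_rV_cons (lebesgue_rV R m)
  end.

Lemma measurable_box (R : realType) n (A : 'I_n -> set R) :
  (forall i, measurable (A i)) ->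
  measurable [set x : 'rV[R]_n | forall i, A i (x ord0 i)].
Proof.
move=> mA; rewrite (_ : mkset _ =
    \bigcap_i ((fun x : 'rV[R]_n => x ord0 i) @^-1` A i)).
  apply: fin_bigcap_measurable => [|i _]; first exact: finite_finset.
  by rewrite -[X in measurable X]setTI; exact: measurable_coord.
by apply/seteqP; split => x H i; [move=> _; exact: H|exact: (H i I)].
Qed.

Lemma lebesgue_rV_box (R : realType) n (A : 'I_n -> set R) :
  (forall i, measurable (A i)) ->
  lebesgue_rV R n [set x | forall i, A i (x ord0 i)] =
  (\prod_(i < n) lebesgue_measure (A i))%E.
Proof.
elim: n A => [|n IH] A mA.
  rewrite big_ord0 /= diracE mem_set// => -[].
  by [].
rewrite big_ord_recl -IH//.
have mB := measurable_box (fun i : 'I_n => mA (lift ord0 i)).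
rewrite -(product_measure1E lebesgue_measure (lebesgue_rV R n) (mA ord0) mB).
rewrite /= /lebesgue_rV_cons; congr ((_ \x _)%E _).
have E0 p : @consrV R n p ord0 ord0 = p.1.
  rewrite /consrV (_ : ord0 = @lshift 1 n ord0 :> 'I_(1 + n)); last exact: val_inj.
  by rewrite (@row_mxEl _ 1 1 n) mxE.
have ES p i : @consrV R n p ord0 (lift ord0 i) = p.2 ord0 i.
  rewrite /consrV (_ : lift ord0 i = @rshift 1 n i :> 'I_(1 + n)); last exact: val_inj.
  by rewrite (@row_mxEr _ 1 1 n).
apply/seteqP; split => p /=.
  by move=> H; split => [|i]; [rewrite -E0|rewrite -ES]; exact: H.
move=> [H0 H1] i; case: (unliftP ord0 i) => [j|] ->; first by rewrite ES.
by rewrite E0.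
Qed.

Section geometry.
Context {R : realType} {d : nat}.
Implicit Types (x y n : 'rV[R]_d) (Om : set 'rV[R]_d).

(* The norm `|x| of the library on 'rV[R]_d is the sup norm. *)
Definition edot x y : R := \sum_(i < d) x ord0 i * y ord0 i.
Definition enorm x : R := Num.sqrt (\sum_(i < d) x ord0 i ^+ 2).
Definition eball x (r : R) : set 'rV[R]_d := [set y | enorm (y - x) < r].

Definition domain Om := [/\ open Om, connected Om & Om !=set0].

Definition bdry Om := closure Om `\` interior Om.

(* Being null for the s-dimensional Hausdorff measure: for every e > 0 there is
   a countable cover by balls with \sum r_k ^ s < e. The index set I is allowed
   to be finite or empty, so that only set0 is null for s = 0. *)
Definition hausdorff_null (s : nat) (A : set 'rV[R]_d) :=
  forall e : R, 0 < e ->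
  exists (I : set nat) (c : nat -> 'rV[R]_d) (r : nat -> R),
    [/\ forall k, I k -> 0 < r k,
        A `<=` \bigcup_(k in I) eball (c k) (r k) &
        (\esum_(k in I) (r k ^+ s)%:E < e%:E)%E].

(* Almost everywhere on the boundary, for the surface measure H^(d-1). *)
Definition surface_ae Om (P : 'rV[R]_d -> Prop) :=
  hausdorff_null d.-1 [set x | bdry Om x /\ ~ P x].

(* n is the outer unit normal of Om at the boundary point x: close to x, every
   cone around -n lies in Om and every cone around n lies outside of Om. *)
Definition outer_normal Om x n :=
  enorm n = 1 /\
  forall e : R, 0 < e -> \forall y \near x,
    (edot (y - x) n < - (e * enorm (y - x)) -> Om y) /\
    (e * enorm (y - x) < edot (y - x) n -> ~ Om y).

End geometry.

Section sobolev.
Context {R : realType} {d : nat}.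
Variable Om : set 'rV[R]_d.
Implicit Types (u v psi phi : 'rV[R]_d -> R).

(* Functions on Om (or on its boundary) are represented by total functions, whose
   values elsewhere are never used. *)

Local Notation vol := (lebesgue_rV R d).

Definition partial (i : 'I_d) psi : 'rV[R]_d -> R := 'D_(delta_mx ord0 i) psi.

(* Compactly supported functions of class C^1 in Om; by mollification they define
   the same weak derivatives of L2 functions as the class C^\infty does. *)
Definition test_function psi :=
  [/\ continuous psi,
      forall i x, derivable psi x (delta_mx ord0 i),
      forall i, continuous (partial i psi) &
      exists K, [/\ compact K, K `<=` Om & forall x, ~ K x -> psi x = 0]].

Definition L2 u :=
  measurable_fun Om u /\ (\int[vol]_(x in Om) (`|u x| ^+ 2)%:E < +oo)%E.

Definition L2norm u : R := Num.sqrt (\int[vol]_(x in Om) (`|u x| ^+ 2)).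

Definition weak_partial (i : 'I_d) u v :=
  forall psi, test_function psi ->
    \int[vol]_(x in Om) (u x * partial i psi x) =
    - \int[vol]_(x in Om) (v x * psi x).

Definition H1 u := L2 u /\ forall i, exists v, L2 v /\ weak_partial i u v.

(* For u in H1, a representative of the weak partial derivative, which is
   unique up to a.e. equality. *)
Definition wpartial (i : 'I_d) u : 'rV[R]_d -> R :=
  get [set v | L2 v /\ weak_partial i u v].

(* v has the boundary value h at x: the averages of |v - h| over Om `&` B(x, r)
   tend to 0 as r tends to 0. If Om is a bounded Lipschitz domain and u is in H1
   then, at H^(d-1)-almost every boundary point, this holds for exactly one h,
   the value of the trace of u. *)
Definition boundary_value v (x : 'rV[R]_d) (h : R) :=
  forall e : R, 0 < e -> \forall r \near 0^'+,
    (\int[vol]_(y in Om `&` eball x r) (`|v y - h|)%:E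
      <= e%:E * vol (Om `&` eball x r))%E.

Definition has_trace u (g : 'rV[R]_d -> R) :=
  surface_ae Om (fun x => boundary_value u x (g x)).

(* The boundary value at x of the derivative of u in the direction n(x). *)
Definition has_normal_derivative u (g : 'rV[R]_d -> R) :=
  surface_ae Om (fun x => exists2 n, outer_normal Om x n &
    boundary_value (fun y => \sum_(i < d) wpartial i u y * n ord0 i) x (g x)).

Definition H10 phi := H1 phi /\ has_trace phi (fun=> 0).

Definition nonzero phi := ~ {ae vol, forall x, Om x -> phi x = 0}.

End sobolev.

Variant boundary_condition := Dirichlet | Neumann.

Section weak_formulation.
Context {R : realType} {d : nat}.
Variable Om : set 'rV[R]_d.
Variable a : 'I_d -> 'I_d -> 'rV[R]_d -> R.
Variable b : 'I_d -> 'rV[R]_d -> R.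
Variables c f g : 'rV[R]_d -> R.
Implicit Types (u phi : 'rV[R]_d -> R).

Local Notation vol := (lebesgue_rV R d).

Definition uniformly_elliptic (theta : R) :=
  forall xi : 'rV[R]_d, {ae vol, forall x, Om x ->
    theta * enorm xi ^+ 2 <=
    \sum_(i < d) \sum_(j < d) a i j x * xi ord0 i * xi ord0 j}.

Definition pairing u phi : R :=
  \int[vol]_(x in Om)
    (\sum_(j < d) \sum_(i < d) a i j x * wpartial Om j u x * wpartial Om i phi x
     + \sum_(i < d) b i x * phi x * wpartial Om i u x
     + c x * u x * phi x - f x * phi x).

(* The maxima over phi are suprema in the extended reals: A[u] need not be
   bounded for the L^2 norm. *)
Definition opnorm u : \bar R :=
  ereal_sup [set (pairing u phi / L2norm Om phi)%:E
            | phi in [set phi | H10 Om phi /\ nonzero Om phi]].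

Definition max_quotient u : \bar R :=
  ereal_sup [set (`|pairing u phi| ^+ 2 / L2norm Om phi ^+ 2)%:E
            | phi in [set phi | H10 Om phi /\ nonzero Om phi]].

Definition minimizer (J : ('rV[R]_d -> R) -> \bar R) u :=
  H1 Om u /\ forall v, H1 Om v -> (J u <= J v)%E.

Definition satisfies_bc (k : boundary_condition) u :=
  match k with
  | Dirichlet => has_trace Om u g
  | Neumann => has_normal_derivative Om u g
  end.

Definition weak_solution (k : boundary_condition) u :=
  [/\ H1 Om u, forall phi, H10 Om phi -> pairing u phi = 0 & satisfies_bc k u].

End weak_formulation.

(* Main.v *)
(* Replacing phi by - phi changes the sign of the pairing, so the quotients
   <A[u], phi> / |phi|_2 form a set of reals that is symmetric about 0; hence the
   supremum of their squares is the square of their supremum, and the supremum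
   is 0 exactly when the pairing with every nonzero phi is 0. As [wpartial]
   chooses a representative, oddness of the pairing (and its vanishing for
   phi = 0 a.e.) rests on a.e. uniqueness of weak partial derivatives, i.e. on
   the fundamental lemma of the calculus of variations: test against C^1
   functions tending to the indicators of the open boxes, a pi-system generating
   the Borel sets. A C^1 bump function gives a nonzero element of H10 (without
   one the suprema would be -oo): it has weak partial derivatives because
   translation invariance makes the integral of any difference quotient of a
   compactly supported C^1 function vanish. *)
Require Import Defs.
From HB Require Import structures.
From mathcomp Require Import all_boot all_order all_algebra.
From mathcomp Require Import all_classical all_reals all_analysis.
From mathcomp Require Import measurable_realfun ring lra.

Set Implicit Arguments.
Unset Strict Implicit.
Unset Printing Implicit Defensive.

Import Order.TTheory GRing.Theory Num.Theory.
Import numFieldNormedType.Exports.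

Local Open Scope classical_set_scope.
Local Open Scope ring_scope.

(** * Integrals of arbitrary functions *)

(* The coefficients a, b, c and f of the problem are arbitrary functions, so the
   integrands of the pairing need not be measurable. *)
Section integral_nonmeasurable.
Context {d : measure_display} {T : measurableType d} {R : realType}.
Variable mu : {measure set T -> \bar R}.
Import HBNNSimple.

Local Open Scope ereal_scope.

(* Every simple function below f is, off the exceptional null set, a simple
   function below g with the same integral; so no measurability is needed. *)
Lemma ge0_ae_le_integralT (f g : T -> \bar R) :
  (forall x, 0 <= f x) -> (forall x, 0 <= g x) ->
  {ae mu, forall x, f x = g x} -> \int[mu]_x f x <= \int[mu]_x g x.
Proof.
move=> f0 g0 [N [mN N0 fgN]]; rewrite !ge0_integralTE//.
apply: ge_ereal_sup => _ [h /= hf <-].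
have mNC := measurableC mN.
have -> : sintegral mu h = sintegral mu (proj_nnsfun h mNC).
  rewrite -!integralT_nnsfun; apply: ae_eq_integral => //.
  - exact/measurable_EFinP.
  - exact/measurable_EFinP.
  exists N; split => // x /= hx; apply: contrapT => Nx; apply: hx => _.
  by rewrite /proj_nnsfun /= mindicE mem_set// mulr1.
apply: ereal_sup_ubound; exists (proj_nnsfun h mNC) => //= x.
rewrite mindicE; case: (boolP (x \in ~` N)) => [/set_mem Nx|_].
  rewrite mulr1 (le_trans (hf x))// (_ : f x = g x)//.
  by apply: contrapT => fgx; apply: Nx; exact: fgN.
by rewrite mulr0.
Qed.

Lemma ae_eq_integral_nonmeasurable (D : set T) (f g : T -> \bar R) :
  {ae mu, forall x, D x -> f x = g x} ->
  \int[mu]_(x in D) f x = \int[mu]_(x in D) g x.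
Proof.
move=> fg; rewrite integral_mkcond [RHS]integral_mkcond integralE [RHS]integralE.
have {}fg : {ae mu, forall x, (f \_ D) x = (g \_ D) x}.
  apply: filterS fg => x fgx; rewrite /patch.
  by case: ifPn => // /set_mem /fgx.
congr (_ - _); apply/eqP; rewrite eq_le; apply/andP; split;
  apply: ge0_ae_le_integralT => //; apply: filterS fg => x;
  by rewrite ?funeposE ?funenegE => ->.
Qed.

(* No integrability is needed: if either part has an infinite integral, then
   [fine] turns both sides into 0. *)
Lemma RintegralN_nonmeasurable (D : set T) (f : T -> R) :
  (\int[mu]_(x in D) (- f x) = - \int[mu]_(x in D) f x)%R.
Proof.
rewrite /Rintegral integralE [in RHS]integralE.
rewrite (_ : (fun x => _^\+ x) = ((EFin \o f)^\-)); last first.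
  by apply/funext => x; rewrite funeposE funenegE /= EFinN.
rewrite (_ : (fun x => (EFin \o (fun=> _))^\- x) = ((EFin \o f)^\+)); last first.
  by apply/funext => x; rewrite funeposE funenegE /= opprK.
have : 0 <= \int[mu]_(x in D) ((EFin \o f)^\- x) by exact: integral_ge0.
have : 0 <= \int[mu]_(x in D) ((EFin \o f)^\+ x) by exact: integral_ge0.
case: (integral mu D _^\+) => [r| |]//; case: (integral mu D _^\-) => [s| |]//=;
  rewrite ?oppr0//.
by move=> _ _; rewrite opprB.
Qed.

Lemma ae_eq_Rintegral_nonmeasurable (D : set T) (f g : T -> R) :
  {ae mu, forall x, D x -> f x = g x} ->
  (\int[mu]_(x in D) f x = \int[mu]_(x in D) g x)%R.
Proof.
move=> fg; congr fine; apply: ae_eq_integral_nonmeasurable.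
by apply: filterS fg => x fgx /fgx ->.
Qed.

End integral_nonmeasurable.

(** * Open boxes generate the Borel sets *)

Section borel_rV.
Context {R : realType} {d : nat}.
Implicit Types (a b x y : 'rV[R]_d) (A : set 'rV[R]_d).

Definition obox a b : set 'rV[R]_d :=
  [set x | forall i, `]a ord0 i, b ord0 i[%classic (x ord0 i)].

(** Closed boxes are compact and of finite volume. A closed box inside [Om] holds the support of the
    bump functions of its open box, which makes them test functions. *)
Definition cbox a b : set 'rV[R]_d :=
  [set x | forall i, `[a ord0 i, b ord0 i]%classic (x ord0 i)].

Definition oboxes := [set A | exists a b, A = obox a b].

Lemma obox_cbox a b : obox a b `<=` cbox a b.
Proof. by move=> x /= abx i; apply: subset_itv_oo_cc; exact: abx. Qed.

Lemma measurable_obox a b : measurable (obox a b).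
Proof. exact: (measurable_box (A := fun i => `]a ord0 i, b ord0 i[%classic)). Qed.

Lemma measurable_cbox a b : measurable (cbox a b).
Proof. exact: (measurable_box (A := fun i => `[a ord0 i, b ord0 i]%classic)). Qed.

Lemma compact_cbox a b : compact (cbox a b).
Proof.
apply: (rV_compact (A := fun i => `[a ord0 i, b ord0 i]%classic)) => i.
exact: segment_compact.
Qed.

Lemma vol_obox a b : lebesgue_rV R d (obox a b) =
  (\prod_(i < d) lebesgue_measure `]a ord0 i, b ord0 i[%classic)%E.
Proof.
exact: (lebesgue_rV_box (A := fun i => `]a ord0 i, b ord0 i[%classic)).
Qed.

Lemma vol_cbox a b : lebesgue_rV R d (cbox a b) =
  (\prod_(i < d) lebesgue_measure `[a ord0 i, b ord0 i]%classic)%E.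
Proof.
exact: (lebesgue_rV_box (A := fun i => `[a ord0 i, b ord0 i]%classic)).
Qed.

Lemma vol_cbox_lty a b : (lebesgue_rV R d (cbox a b) < +oo)%E.
Proof.
rewrite vol_cbox ltey_eq; apply/orP; left.
elim/big_ind: _ => // [x y|i _]; first exact: fin_numM.
by rewrite lebesgue_measure_itv /=; case: ifP.
Qed.

Definition rV_max a b : 'rV[R]_d := \row_i Num.max (a ord0 i) (b ord0 i).
Definition rV_min a b : 'rV[R]_d := \row_i Num.min (a ord0 i) (b ord0 i).

Lemma oboxI a b a' b' :
  obox a b `&` obox a' b' = obox (rV_max a a') (rV_min b b').
Proof.
apply/seteqP; split => x /=.
  move=> [H H'] i; have := H i; have := H' i; rewrite !mxE /= !in_itv /=.
  by rewrite gt_max lt_min => /andP[a1 b1] /andP[a2 b2]; rewrite a1 a2 b1 b2.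
move=> H; split => i; have := H i; rewrite !mxE /= !in_itv /=;
  by rewrite gt_max lt_min => /andP[/andP[? ?] /andP[? ?]]; apply/andP.
Qed.

Lemma cboxI_sub a b a' b' : cbox (rV_max a a') (rV_min b b') `<=` cbox a b.
Proof.
move=> x H i; have := H i; rewrite /= !mxE !in_itv /= ge_max le_min.
by move=> /andP[/andP[? ?] /andP[? ?]]; apply/andP.
Qed.

Lemma obox_setI : setI_closed oboxes.
Proof.
by move=> _ _ [a [b ->]] [a' [b' ->]]; rewrite oboxI; eexists; eexists.
Qed.

Definition cube (k : nat) : set 'rV[R]_d := obox (const_mx (- k%:R)) (const_mx k%:R).

Lemma bigcup_cube : \bigcup_k cube k = setT.
Proof.
apply/seteqP; split => // x _.
have [k xk] : exists k : nat, `|x| < k%:R.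
  by exists (Num.bound `|x|); exact: archi_boundP.
exists k => // i /=; rewrite !mxE in_itv/= -ltr_norml.
apply: le_lt_trans xk; rewrite [leRHS]/Num.norm /= mx_normrE.
exact: (le_bigmax _ (fun ij : 'I_1 * 'I_d => `|x ij.1 ij.2|) (ord0, i)).
Qed.

(** The generators of the sigma-algebra are preimages of Borel sets of the line under one
    coordinate. For an open interval such a preimage is a slab, a countable union of open boxes. *)
Lemma measurable_oboxesE : @measurable _ 'rV[R]_d = <<s oboxes >>.
Proof.
apply/seteqP; split; last first.
  apply: smallest_sub; first exact: sigma_algebra_measurable.
  by move=> _ [a [b ->]]; exact: measurable_obox.
apply: smallest_sub; first exact: smallest_sigma_algebra.
move=> A; rewrite -bigcup_seq => -[i _] [B mB <-]; rewrite setTI.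
have {}mB : <<s @RGenOpens.G R >> B.
  suff <- : measurable = <<s @RGenOpens.G R >> by [].
  exact: RGenOpens.measurableE.
(* The sets [B] with a good preimage form a sigma-algebra, so open intervals suffice. *)
pose S := [set B : set R | <<s oboxes >> ((fun x : 'rV[R]_d => x ord0 i) @^-1` B)].
apply: (@smallest_sub _ _ _ S _ _ _ mB).
  split => [|C SC|F SF]; rewrite /S /=.
  - by rewrite preimage_set0; exact: sigma_algebra0.
  - by rewrite setTD preimage_setC -setTD; exact: sigma_algebraCD.
  - by rewrite preimage_bigcup; exact: sigma_algebra_bigcup.
move=> _ [u [v ->]]; rewrite /S /=.
(* Cutting the slab with the cubes makes it bounded in the coordinates other than [i]. *)
rewrite (_ : _ @^-1` _ = \bigcup_k (cube k `&`
   obox (\row_j if j == i then u else - k%:R) (\row_j if j == i then v else k%:R))).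
  apply: sigma_algebra_bigcup => k; apply: sub_sigma_algebra.
  by apply: obox_setI; [exists (const_mx (- k%:R)), (const_mx k%:R)|
    eexists; eexists; reflexivity].
apply/seteqP; split => x /=; last first.
  by move=> [k _ [_ /(_ i)]] /=; rewrite !mxE eqxx.
have : (\bigcup_k cube k) x by rewrite bigcup_cube.
move=> [k _ xk] uvx; exists k => //; split => // j /=; rewrite !mxE.
by case: eqP => [->//|_]; have := xk j; rewrite /= !mxE.
Qed.

(** The boxes are the cubes with rational centre and half-side 1/(n+1) whose closure lies in [A];
    every other index of the enumeration gets the empty set. *)
Lemma obox_cover A : open A ->
  exists F : nat -> set 'rV[R]_d, A = \bigcup_k F k /\
    forall k, F k = set0 \/ exists a b, F k = obox a b /\ cbox a b `<=` A.
Proof.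
move=> oA.
pose q (p : 'rV[rat]_d) : 'rV[R]_d := map_mx (fun z => ratr z) p.
pose l (p : 'rV[rat]_d * nat) := q p.1 - const_mx p.2.+1%:R^-1.
pose r (p : 'rV[rat]_d * nat) := q p.1 + const_mx p.2.+1%:R^-1.
pose F k : set 'rV[R]_d := if (unpickle k : option ('rV[rat]_d * nat)) is Some p
  then [set x | obox (l p) (r p) x /\ cbox (l p) (r p) `<=` A] else set0.
exists F; split; last first.
  move=> k; rewrite /F; case: unpickle => [p|]; last by left.
  have [sA|nsA] := pselect (cbox (l p) (r p) `<=` A).
    right; exists (l p), (r p); split => //.
    by apply/seteqP; split => x // -[].
  by left; apply/seteqP; split => x // -[].
apply/seteqP; split => x; last first.
  move=> [k _]; rewrite /F; case: unpickle => // p [/obox_cbox ? +]; exact.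
move=> Ax; have := open_nbhs_nbhs (conj oA Ax).
rewrite -nbhs_ballE => -[e /= e0 eA].
(* With half-side [s] and a centre closer than [s] to [x], every point of the closed box is closer
   than 2s < e to [x]. *)
have [n ne] : exists n : nat, n.+1%:R^-1 < e / 2.
  exists (Num.bound (e / 2)^-1); rewrite invf_plt ?posrE ?divr_gt0//.
  apply: (@lt_trans _ _ (Num.bound (e / 2)^-1)%:R); last by rewrite ltr_nat.
  by apply: archi_boundP; rewrite invr_ge0 divr_ge0// ltW.
pose s : R := n.+1%:R^-1; have s0 : 0 < s by rewrite invr_gt0.
have /choice[p hp] : forall i : 'I_d, exists z : rat,
    ratr z \in `]x ord0 i - s, x ord0 i + s[.
  by move=> i; apply: rat_in_itvoo; rewrite ltrBlDr -addrA ltrDl addr_gt0.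
exists (pickle (\row_i p i, n)) => //; rewrite /F pickleK; split.
  move=> i; rewrite /= !mxE /= in_itv/=.
  by move: (hp i); rewrite -/s in_itv /= => /andP[]; lra.
move=> y yb; apply: eA; split => // i j; rewrite !ord1 /ball /= ltr_distl.
have := yb j; rewrite /= !mxE /= in_itv/= => /andP[].
by move: (hp j) ne; rewrite -/s in_itv /= => /andP[]; lra.
Qed.

(** This links the topology of ['rV[R]_d] to a sigma-algebra that is defined from the coordinates
    alone. *)
Lemma open_measurable_rV A : open A -> measurable A.
Proof.
move=> /obox_cover[F [-> FE]]; apply: bigcupT_measurable => k.
by case: (FE k) => [->//|[a [b [-> _]]]]; exact: measurable_obox.
Qed.

Lemma continuous_measurable_rV A (f : 'rV[R]_d -> R) :
  measurable A -> continuous f -> measurable_fun A f.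
Proof.
move=> mA /continuousP cf; apply: (measurability _ (RGenOpens.measurableE R)).
move=> _ [_ [u [v ->]] <-]; apply: measurableI => //.
by apply: open_measurable_rV; apply: cf; exact: interval_open.
Qed.

End borel_rV.

(** * Translation invariance of the Lebesgue measure *)

Section translation.
Context {R : realType} {d : nat}.
Implicit Types (v x : 'rV[R]_d) (A : set 'rV[R]_d).

Local Notation vol := (lebesgue_rV R d).

Lemma measurable_shift v : measurable_fun setT (shift v : 'rV[R]_d -> 'rV[R]_d).
Proof.
apply: measurable_fun_rVP => i.
rewrite (_ : (fun _ => _) = fun x : 'rV[R]_d => x ord0 i + v ord0 i).
  by apply: measurable_funD => //; exact: measurable_coord.
by apply/funext => x; rewrite /= mxE.
Qed.

(** Both sides are measures of [A] that agree on the pi-system of open boxes, where the volume is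
    the product of the side lengths; the cubes exhaust the space and have finite volume. *)
Lemma vol_shift v A : measurable A -> vol (shift v @^-1` A) = vol A.
Proof.
move=> mA; rewrite -[LHS]/(pushforward vol (shift v) A); apply/esym.
apply: (measure_unique (@oboxes R d) (@cube R d)) => //.
- exact: measurable_oboxesE.
- exact: obox_setI.
- by move=> k; exists (const_mx (- k%:R)), (const_mx k%:R).
- exact: bigcup_cube.
- exact: measurable_shift.
- move=> mS _ [a [b ->]]; rewrite /= /pushforward.
  rewrite (_ : _ @^-1` _ = obox (a - v) (b - v)); last first.
    apply/seteqP; split => x H i; have := H i;
      by rewrite /= !mxE !in_itv/= ltrBlDr ltrBrDr.
  rewrite !vol_obox; apply: eq_bigr => i _; rewrite !mxE !lebesgue_measure_itv /=.
  rewrite !lte_fin ltrD2r; case: ifPn => // _.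
  by rewrite -!EFinD; congr (_%:E); ring.
- move=> k; apply: le_lt_trans (vol_cbox_lty (const_mx (- k%:R)) (const_mx k%:R)).
  apply: le_measure; rewrite ?inE; [exact: measurable_obox|exact: measurable_cbox|].
  exact: obox_cbox.
Qed.

Let integral_shiftE v (f : 'rV[R]_d -> \bar R) :
  (\int[vol]_x f x = \int[pushforward vol (shift v)]_x f x)%E.
Proof.
have mS := measurable_shift v.
by apply: eq_measure_integral => A mA _; exact/esym/vol_shift.
Qed.

Lemma integrable_shift v (f : 'rV[R]_d -> \bar R) :
  vol.-integrable setT f -> vol.-integrable setT (f \o shift v).
Proof.
move=> fi; have mS := measurable_shift v; have mf := measurable_int _ fi.
apply/integrableP; split; first exact: measurableT_comp.
have /integrableP[_] := fi; rewrite (integral_shiftE v).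
rewrite ge0_integral_pushforward//; exact: measurableT_comp.
Qed.

Lemma integral_shift v (f : 'rV[R]_d -> \bar R) : vol.-integrable setT f ->
  (\int[vol]_x f (shift v x) = \int[vol]_x f x)%E.
Proof.
move=> fi; have mS := measurable_shift v; have mf := measurable_int _ fi.
rewrite [RHS](integral_shiftE v) integral_pushforward//= preimage_setT.
exact: integrable_shift.
Qed.

End translation.

(** * Functions of class C^1 with compact support *)

Section partial_derivatives.
Context {R : realType} {d : nat}.
Implicit Types (x : 'rV[R]_d) (psi phi F : 'rV[R]_d -> R) (K A : set 'rV[R]_d).

Local Notation vol := (lebesgue_rV R d).

(** The regularity clauses of [test_function] without the support: the one-coordinate factors of a
    bump function need not have compact support. *)
Definition C1 psi := [/\ continuous psi,
  forall i x, derivable psi x (delta_mx ord0 i) &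
  forall i, continuous (partial i psi)].

Lemma partialM (i : 'I_d) psi phi x :
  derivable psi x (delta_mx ord0 i) -> derivable phi x (delta_mx ord0 i) ->
  partial i (psi \* phi) x = psi x * partial i phi x + phi x * partial i psi x.
Proof. by move=> dpsi dphi; rewrite /partial deriveM. Qed.

Lemma C1M psi phi : C1 psi -> C1 phi -> C1 (psi \* phi).
Proof.
move=> [cpsi dpsi cdpsi] [cphi dphi cdphi]; split.
- by move=> x; apply: continuousM; [exact: cpsi|exact: cphi].
- by move=> i x; exact: derivableM.
move=> i; rewrite (_ : partial i _ =
    (psi \* partial i phi) + (phi \* partial i psi)); last first.
  by apply/funext => x; rewrite partialM.
by move=> x; apply: continuousD; apply: continuousM;
  [exact: cpsi|exact: cdphi|exact: cphi|exact: cdpsi].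
Qed.

Lemma C1_cst (r : R) : C1 (cst r).
Proof.
split => [x|i x|i x]; [exact: cst_continuous|exact: derivable_cst|].
rewrite (_ : partial i _ = cst 0); first exact: cst_continuous.
by apply/funext => y; rewrite /partial derive_cst.
Qed.

Lemma C1_prod (I : Type) (s : seq I) (psi : I -> 'rV[R]_d -> R) :
  (forall i, C1 (psi i)) -> C1 (fun x => \prod_(i <- s) psi i x).
Proof.
move=> H; elim: s => [|i s IH].
  rewrite (_ : (fun _ => _) = cst 1); first exact: C1_cst.
  by apply/funext => x; rewrite big_nil.
rewrite (_ : (fun _ => _) = psi i \* (fun x => \prod_(j <- s) psi j x)).
  exact: C1M.
by apply/funext => x; rewrite big_cons.
Qed.

(** By the chain rule, the partial derivative along the axis [i] is the derivative of [h] times the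
    Kronecker delta of [i] and [j]. *)
Lemma C1_coord (h : R -> R) (j : 'I_d) :
  (forall t, derivable h t 1) -> continuous (derive1 h) ->
  C1 (fun x => h (x ord0 j)).
Proof.
move=> dh ch.
have dif x : differentiable (h \o (fun y : 'rV[R]_d => y ord0 j)) x.
  apply: differentiable_comp; first exact: differentiable_coord.
  exact/derivable1_diffP.
have cc : continuous (fun y : 'rV[R]_d => y ord0 j) by exact: coord_continuous.
split => [x|i x|i].
- exact: differentiable_continuous.
- exact: diff_derivable.
rewrite (_ : partial i _ =
    (derive1 h \o (fun x : 'rV[R]_d => x ord0 j)) \* cst (j == i)%:R).
  move=> x; apply: continuousM; last exact: cst_continuous.
  by apply: continuous_comp; [exact: cc|exact: ch].
apply/funext => x.
rewrite /partial deriveE// diff_comp//; last 2 first.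
- exact: differentiable_coord.
- exact/derivable1_diffP.
rewrite /= deriv1E//= -deriveE; last exact: differentiable_coord.
have /derive_mx : derivable (@id 'rV[R]_d) x (delta_mx ord0 i).
  exact: derivable_id.
rewrite derive_id => /matrixP/(_ ord0 j); rewrite !mxE eqxx/= => <-.
by rewrite mulrC.
Qed.

Lemma partial_eq0 (i : 'I_d) psi K x : closed K ->
  (forall x, ~ K x -> psi x = 0) -> ~ K x -> partial i psi x = 0.
Proof.
move=> cK psi0 Kx; rewrite /partial (@near_eq_derive _ _ _ psi (cst 0) x).
  by rewrite derive_cst.
have : open_nbhs x (~` K) by split => //; exact: closed_openC.
by move/open_nbhs_nbhs; apply: filterS => y /psi0.
Qed.

Lemma compact_cbox_sub K : compact K -> exists2 N : R, 0 < N &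
  K `<=` cbox (const_mx (- N)) (const_mx N).
Proof.
move=> /compact_bounded/pinfty_ex_gt0[N N0 KN]; exists N => // x /KN /= xN i.
rewrite /= !mxE in_itv/= -ler_norml; apply: le_trans xN.
rewrite [leRHS]/Num.norm /= mx_normrE.
exact: (le_bigmax _ (fun ij : 'I_1 * 'I_d => `|x ij.1 ij.2|) (ord0, i)).
Qed.

Lemma continuous_compact_bound psi K : continuous psi -> compact K ->
  (forall x, ~ K x -> psi x = 0) -> exists2 M : R, 0 < M & forall x, `|psi x| <= M.
Proof.
move=> cpsi cK psi0.
have /compact_bounded/pinfty_ex_gt0[M M0 KM] : compact (psi @` K).
  by apply: continuous_compact => //; exact: continuous_subspaceT.
exists M => // x; have [Kx|/psi0->] := pselect (K x).
  by apply: (KM (psi x)); exists x.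
by rewrite normr0 ltW.
Qed.

Lemma integrable_compact_support psi K : continuous psi -> compact K ->
  (forall x, ~ K x -> psi x = 0) -> vol.-integrable setT (EFin \o psi).
Proof.
move=> cpsi cK psi0; have [M M0 psiM] := continuous_compact_bound cpsi cK psi0.
have [N N0 KN] := compact_cbox_sub cK.
set B := cbox _ _ in KN.
have : vol.-integrable B (EFin \o psi).
  apply: measurable_bounded_integrable.
  - exact: measurable_cbox.
  - exact: vol_cbox_lty.
  - by apply: continuous_measurable_rV => //; exact: measurable_cbox.
  - by exists M; split => [|y My x _]; [exact: num_real|
      exact: le_trans (psiM x) (ltW My)].
move/(integrable_mkcond _ (measurable_cbox _ _)).
apply: eq_integrable => // x _; rewrite patchE; case: ifPn => // /negP xB.
by rewrite /= psi0// => /KN; move/mem_set.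
Qed.

(** The mean value theorem on the segment from [x] in direction [i]. The bound dominates difference
    quotients uniformly in the increment. *)
Lemma C1_lipschitz (i : 'I_d) psi (M : R) : C1 psi ->
  (forall x, `|partial i psi x| <= M) ->
  forall x (h : R), 0 <= h ->
  `|psi (h *: delta_mx ord0 i + x) - psi x| <= M * h.
Proof.
move=> [cpsi dpsi _] psiM x h h0.
pose e : 'rV[R]_d := delta_mx ord0 i.
pose g (t : R) := psi (t *: e + x).
have gd (t : R) : is_derive t 1 g (partial i psi (t *: e + x)).
  have E : (fun z : R => z^-1 *: ((g \o shift t) (z *: 1) - g t)) =
      (fun z => z^-1 *: ((psi \o shift (t *: e + x)) (z *: e) - psi (t *: e + x))).
    by apply/funext => z; rewrite /g /= [z *: 1]mulr1 scalerDl addrA.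
  by split; rewrite /derivable /derive E//; exact: dpsi.
have gc : continuous g.
  move=> t; apply: differentiable_continuous; apply/derivable1_diffP.
  exact: ex_derive.
have [c _] := MVT_segment h0 (fun t _ => gd t) (continuous_subspaceT gc).
rewrite /g scale0r add0r subr0 => ->; rewrite normrM (ger0_norm h0).
exact: ler_wpM2r.
Qed.

(** The difference quotients with increments [h n] all have integral 0. They tend pointwise to the
    partial derivative, and the Lipschitz bound on a box provides the domination. *)
Lemma integral_partial0 (i : 'I_d) psi K : C1 psi -> compact K ->
  (forall x, ~ K x -> psi x = 0) -> (\int[vol]_x (partial i psi x)%:E = 0)%E.
Proof.
move=> Cpsi cK psi0; have [cpsi dpsi cdpsi] := Cpsi.
have clK : closed K by exact: compact_closed.
have dpsi0 x : ~ K x -> partial i psi x = 0 by exact: partial_eq0.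
have [M M0 dpsiM] := continuous_compact_bound (cdpsi i) cK dpsi0.
have [N N0 KN] := compact_cbox_sub cK.
pose e : 'rV[R]_d := delta_mx ord0 i.
pose h (n : nat) : R := n.+1%:R^-1.
have h0 n : 0 < h n by rewrite invr_gt0.
have h1 n : h n <= 1 by rewrite invf_le1 // ler1n.
(* The margin 1 is there because [h n] is at most 1: for [x] outside [B], neither [x] nor its
   translate by [h n *: e] lies in [K]. *)
pose B := cbox (const_mx (- (N + 1))) (const_mx (N + 1)) : set 'rV[R]_d.
pose f_ n x := ((h n)^-1 * (psi (h n *: e + x) - psi x))%:E.
pose G := (EFin \o cst M) \_ B.
have ipsi : vol.-integrable setT (EFin \o psi).
  exact: integrable_compact_support cpsi cK psi0.
have shiftE n : (fun x => psi (h n *: e + x)) = psi \o shift (h n *: e).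
  by apply/funext => x; rewrite addrC.
have ishift n : vol.-integrable setT (EFin \o (fun x => psi (h n *: e + x))).
  by rewrite shiftE; exact: (@integrable_shift _ _ (h n *: e) (EFin \o psi)).
have f_0 n : (\int[vol]_x f_ n x = 0)%E.
  rewrite /f_; under eq_integral do rewrite EFinM.
  rewrite integralZl//; last first.
    by under eq_fun do rewrite EFinB; exact: (integrableB _ (ishift n)).
  rewrite integralB_EFin//.
  under eq_integral do rewrite addrC.
  rewrite (@integral_shift _ _ (h n *: e) (EFin \o psi)).
    by rewrite /= subee ?mule0//; exact: integrable_fin_num.
  exact: ipsi.
have [] := @dominated_convergence _ _ R vol setT measurableT f_
  (EFin \o partial i psi) G.
- move=> n; apply/measurable_EFinP; apply: measurable_funM => //.
  apply: measurable_funB; last exact: continuous_measurable_rV.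
  apply/measurable_EFinP; exact: measurable_int (ishift n).
- by apply/measurable_EFinP; exact: continuous_measurable_rV.
- apply: aeW => x _; apply/fine_cvgP; split; first by apply: nearW => n.
  (* The derivative is a limit over nonzero increments, so [h] has to converge in the punctured
     neighbourhoods of 0. *)
  have hd : h @ \oo --> 0^'.
    move=> P /cvg_harmonic HP.
    have {HP} : \forall n \near \oo, h n != 0 -> P (h n) by exact: HP.
    by apply: filterS => n; apply; exact: lt0r_neq0.
  exact: (cvg_comp _ _ hd (dpsi i x)).
- apply/(integrable_mkcond _ (measurable_cbox _ _)).
  apply: measurable_bounded_integrable.
  + exact: measurable_cbox.
  + exact: vol_cbox_lty.
  + exact: measurable_cst.
  + by exists M; split => [|y My x _]; [exact: num_real|rewrite /= gtr0_norm// ltW].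
- apply: aeW => x n _; rewrite /f_ /G patchE; case: ifPn => [_|/negP xB] /=.
    rewrite lee_fin normrM gtr0_norm ?invr_gt0// ler_pdivrMl// mulrC.
    exact: C1_lipschitz (ltW (h0 n)).
  have KB y : K y -> forall j, `|y ord0 j| <= N.
    by move=> /KN Ky j; have := Ky j; rewrite /= !mxE in_itv/= ler_norml.
  rewrite !psi0 ?subrr ?mulr0 ?normr0// => Ky; apply: xB; apply/mem_set => j.
    have := KB _ Ky j; rewrite /= !mxE in_itv/= !ler_norml => /andP[].
    by lra.
  have := KB _ Ky j; have := h1 n; have := h0 n.
  rewrite /= !mxE in_itv/= !ler_norml.
  by case: (_ == _) => /=; rewrite ?mulr0n ?mulr1n => ? ? /andP[]; lra.
- move=> _ _; rewrite (_ : [sequence _]_n = cst 0%E); last exact/funext.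
  by move/cvg_lim => <- //; exact: lim_cst.
Qed.

End partial_derivatives.

(** * Bump functions *)

Section smooth_step.
Context {R : realType}.
Implicit Types (h : R -> R) (t : R).

Definition C1_1d h := (forall t, derivable h t 1) /\ continuous (derive1 h).

Lemma is_derive_C1_1d h (dh : R -> R) : continuous dh ->
  (forall t, is_derive t 1 h (dh t)) -> C1_1d h.
Proof.
move=> cdh hdh; split => [t|]; first exact: ex_derive.
rewrite (_ : derive1 h = dh)//; apply/funext => t.
by rewrite derive1E derive_val.
Qed.

Lemma C1_1d_affine (c k : R) : C1_1d (fun t => c + k * t).
Proof.
apply: (@is_derive_C1_1d _ (cst k)); first exact: cst_continuous.
move=> t.
have /is_derive_eq :
    is_derive t (1 : R) (cst c + k \*: (@id R)) (0 + k *: 1).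
  exact: is_deriveD.
by apply; rewrite add0r [LHS]mulr1.
Qed.

Lemma C1_1d_comp h1 h2 : C1_1d h1 -> C1_1d h2 -> C1_1d (h1 \o h2).
Proof.
move=> [d1 c1] [d2 c2]; split => [t|].
  apply/derivable1_diffP; apply: differentiable_comp; exact/derivable1_diffP.
rewrite (_ : derive1 _ = (derive1 h1 \o h2) * derive1 h2); last first.
  by apply/funext => t; rewrite derive1_comp.
move=> t; apply: continuousM; last exact: c2.
apply: continuous_comp; last exact: c1.
exact/differentiable_continuous/derivable1_diffP.
Qed.

(** Divided by the increment [e], the error is at most the absolute value of [e]. This handles
    [sqr_pos], whose defining formula contains an absolute value that is not differentiable at 0. *)
Lemma quadratic_is_derive h t (l : R) :
  (forall e, `|h (e + t) - h t - l * e| <= e ^+ 2) -> is_derive t 1 h l.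
Proof.
move=> H.
suff dh : (fun e => e^-1 *: ((h \o shift t) (e *: 1) - h t)) @ 0^' --> l.
  by apply: DeriveDef; [apply/cvg_ex; exists l|exact: cvg_lim].
apply/cvgrPdist_le => e e0; near=> x.
have x0 : x != 0 by near: x; exact: nbhs_dnbhs_neq.
have xe : `|x| <= e by near: x; exact: dnbhs0_le.
apply: le_trans xe; rewrite /= [x *: 1]mulr1 distrC.
rewrite (_ : _ - _ = x^-1 * (h (x + t) - h t - l * x)); last first.
  by rewrite /GRing.scale /=; field.
rewrite normrM normfV ler_pdivrMl ?normr_gt0// (le_trans (H x))//.
by rewrite -normrM -expr2 ger0_norm// sqr_ge0.
Unshelve. all: by end_near.
Qed.

(** The square of the positive part of [t]; its derivative [t + |t|] is continuous. *)
Definition sqr_pos t := ((t + `|t|) / 2) ^+ 2.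

Lemma sqr_pos_le0 t : t <= 0 -> sqr_pos t = 0.
Proof. by move=> t0; rewrite /sqr_pos ler0_norm// subrr mul0r expr0n. Qed.

Lemma sqr_pos_ge0 t : 0 <= t -> sqr_pos t = t ^+ 2.
Proof. by move=> t0; rewrite /sqr_pos ger0_norm//; congr (_ ^+ 2); field. Qed.

Lemma C1_1d_sqr_pos : C1_1d sqr_pos.
Proof.
apply: (@is_derive_C1_1d _ ((@id R) + (@Num.norm R R))).
  by move=> t; apply: continuousD; [exact: cvg_id|exact: norm_continuous].
move=> t; apply: quadratic_is_derive => e; rewrite /= ler_norml.
change ((id + @Num.norm R R) t) with (t + `|t|).
have [t0|/ltW t0] := leP 0 t; have [e0|/ltW e0] := leP 0 (e + t).
- by rewrite !sqr_pos_ge0// ger0_norm//; apply/andP; split; nra.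
- by rewrite sqr_pos_le0// sqr_pos_ge0// ger0_norm//; apply/andP; split; nra.
- by rewrite sqr_pos_ge0// sqr_pos_le0// ler0_norm//; apply/andP; split; nra.
- by rewrite !sqr_pos_le0// ler0_norm//; apply/andP; split; nra.
Qed.

(** A C^1 transition from 0 on the negative half-line to 1 beyond 1, equal to 1 - (1 - t^2)^2 in
    between. Being a composition of affine maps and [sqr_pos], it inherits its regularity from
    them. *)
Definition step t := 1 - sqr_pos (1 - sqr_pos t).

Lemma C1_1d_step (k c : R) : C1_1d (fun t => step (c + k * t)).
Proof.
rewrite (_ : (fun t => _) = (fun t => 1 + (-1) * t) \o sqr_pos \o
  (fun t => 1 + (-1) * t) \o sqr_pos \o (fun t => c + k * t)).
  apply: C1_1d_comp; last exact: C1_1d_affine.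
  apply: C1_1d_comp; last exact: C1_1d_sqr_pos.
  apply: C1_1d_comp; last exact: C1_1d_affine.
  apply: C1_1d_comp; last exact: C1_1d_sqr_pos.
  exact: C1_1d_affine.
by apply/funext => t; rewrite /= !mulN1r.
Qed.

Lemma step_le0 t : t <= 0 -> step t = 0.
Proof.
by move=> t0; rewrite /step (sqr_pos_le0 t0) subr0 sqr_pos_ge0// expr1n subrr.
Qed.

Lemma step_ge1 t : 1 <= t -> step t = 1.
Proof.
move=> t1; rewrite /step [X in 1 - X]sqr_pos_le0 ?subr0//.
rewrite sqr_pos_ge0 ?(le_trans _ t1)// subr_le0 -(expr1n _ 2).
by rewrite ler_sqr ?nnegrE// (le_trans _ t1).
Qed.

Lemma step_ge0_le1 t : 0 <= step t <= 1.
Proof.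
have [t0|/ltW t0] := leP 0 t; last by rewrite step_le0// lexx ler01.
have [t1|/ltW t1] := leP 1 t; first by rewrite step_ge1// lexx ler01.
have u0 := sqr_ge0 t; have u1 : t ^+ 2 <= 1 by rewrite expr_le1.
rewrite /step (sqr_pos_ge0 t0) sqr_pos_ge0 ?subr_ge0//.
by apply/andP; split; nra.
Qed.

Lemma step_gt0 (t : R) : 0 < t -> 0 < step t.
Proof.
move=> t0; have [t1|t1] := leP 1 t; first by rewrite step_ge1.
have u0 : 0 < t ^+ 2 by rewrite exprn_gt0.
have u1 : t ^+ 2 < 1 by rewrite expr_lt1// ltW.
by rewrite /step (sqr_pos_ge0 (ltW t0)) sqr_pos_ge0 ?subr_ge0 ?ltW//; nra.
Qed.

End smooth_step.

Section bump.
Context {R : realType} {d : nat}.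
Implicit Types (a b x : 'rV[R]_d) (k : nat).

(** Each factor compares the signed distance to a face with 1/k: the product is 0 outside the open
    box and 1 at the points at distance at least 1/k from every face. Hence the limit in [k] is the
    indicator of the open box. *)
Definition bump a b k x := \prod_(i < d)
  (step (k%:R * (x ord0 i - a ord0 i)) * step (k%:R * (b ord0 i - x ord0 i))).

Lemma C1_bump a b k : C1 (bump a b k).
Proof.
apply: C1_prod => i.
apply: (@C1M _ _ (fun x => step (k%:R * (x ord0 i - a ord0 i)))
                 (fun x => step (k%:R * (b ord0 i - x ord0 i)))).
  rewrite (_ : (fun _ => _) = fun x : 'rV[R]_d =>
      (fun t => step (- (k%:R * a ord0 i) + k%:R * t)) (x ord0 i)).
    by have [dh ch] := C1_1d_step k%:R (- (k%:R * a ord0 i)); exact: C1_coord dh ch.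
  by apply/funext => x; congr step; ring.
rewrite (_ : (fun _ => _) = fun x : 'rV[R]_d =>
    (fun t => step (k%:R * b ord0 i + (- k%:R) * t)) (x ord0 i)).
  by have [dh ch] := C1_1d_step (- k%:R) (k%:R * b ord0 i); exact: C1_coord dh ch.
by apply/funext => x; congr step; ring.
Qed.

Lemma bump_eq0 a b k x : ~ obox a b x -> bump a b k x = 0.
Proof.
move=> /existsNP[i] /negP; rewrite in_itv /= negb_and -!leNgt => abx.
rewrite /bump (bigD1 i)//= [X in X * _](_ : _ = 0) ?mul0r//.
by case/orP: abx => abx; [rewrite step_le0 ?mul0r//|rewrite mulrC step_le0 ?mul0r//];
  rewrite mulr_ge0_le0// subr_le0.
Qed.

Lemma normr_bump_le1 a b k x : `|bump a b k x| <= 1.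
Proof.
rewrite /bump normr_prod; apply: prodr_ile1 => i _; rewrite normr_ge0 normrM /=.
have /andP[s0 s1] := step_ge0_le1 (k%:R * (x ord0 i - a ord0 i)).
have /andP[r0 r1] := step_ge0_le1 (k%:R * (b ord0 i - x ord0 i)).
by rewrite !ger0_norm// mulr_ile1.
Qed.

Lemma bump_near1 a b x : obox a b x -> \forall k \near \oo, bump a b k x = 1.
Proof.
move=> abx.
have H (t : R) : 0 < t -> \forall k \near \oo, 1 <= k%:R * t.
  move=> t0; exists (Num.bound t^-1) => // k /= tk.
  rewrite -ler_pdivrMr// mul1r; apply: ltW.
  apply: (lt_le_trans (archi_boundP _)); first by rewrite invr_ge0 ltW.
  by rewrite ler_nat.
have : \forall k \near \oo, forall i : 'I_d,
    1 <= k%:R * (x ord0 i - a ord0 i) /\ 1 <= k%:R * (b ord0 i - x ord0 i).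
  apply: filter_forall => i; have := abx i; rewrite /= in_itv/= => /andP[ax xb].
  by apply: filterI; apply: H; rewrite subr_gt0.
apply: filterS => k H1; rewrite /bump big1// => i _.
by have [? ?] := H1 i; rewrite !step_ge1// mulr1.
Qed.

Lemma test_function_bump Om a b k :
  cbox a b `<=` Om -> test_function Om (bump a b k).
Proof.
move=> abOm; have [c1 c2 c3] := C1_bump a b k; split => //.
exists (cbox a b); split => //; first exact: compact_cbox.
by move=> x abx; apply: bump_eq0 => /obox_cbox.
Qed.

End bump.

(** * The fundamental lemma of the calculus of variations *)

Section weak_derivatives.
Context {R : realType} {d : nat}.
Variable Om : set 'rV[R]_d.
Hypothesis oOm : open Om.
Implicit Types (w u v psi phi : 'rV[R]_d -> R).

Local Notation vol := (lebesgue_rV R d).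

Let mOm : measurable Om := open_measurable_rV oOm.

Lemma integral_support (A : set 'rV[R]_d) w : (forall x, ~ A x -> w x = 0) ->
  (\int[vol]_(x in A) (w x)%:E = \int[vol]_x (w x)%:E)%E.
Proof.
move=> w0; rewrite integral_mkcond; apply: eq_integral => x _.
by rewrite patchE; case: ifPn => // /negP xA; rewrite w0// => /mem_set.
Qed.

(** Integration by parts: the sum of the two integrands is the partial derivative of the product,
    which vanishes off a compact subset of [Om], so its integral is one over the whole space and
    equals 0. *)
Lemma test_weak_partial (i : 'I_d) phi : test_function Om phi ->
  weak_partial Om i phi (partial i phi).
Proof.
move=> [cphi dphi cdphi _ ] psi [cpsi dpsi cdpsi [K [cK KOm psi0]]].
have clK : closed K by exact: compact_closed.
have dpsi0 x : ~ K x -> partial i psi x = 0 by exact: partial_eq0.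
apply/eqP; rewrite -subr_eq0 opprK; apply/eqP.
have Cphipsi : C1 (phi \* psi) by apply: C1M; split.
have int1 : vol.-integrable Om (EFin \o (fun x => phi x * partial i psi x)).
  apply: (integrableS measurableT) => //.
  apply: (@integrable_compact_support _ _ _ K) => //.
    by move=> x; apply: continuousM; [exact: cphi|exact: cdpsi].
  by move=> x /dpsi0 ->; rewrite mulr0.
have int2 : vol.-integrable Om (EFin \o (fun x => partial i phi x * psi x)).
  apply: (integrableS measurableT) => //.
  apply: (@integrable_compact_support _ _ _ K) => //.
    by move=> x; apply: continuousM; [exact: cdphi|exact: cpsi].
  by move=> x /psi0 ->; rewrite mulr0.
rewrite -RintegralD// /Rintegral.
under eq_integral.
  move=> x _; rewrite (_ : _ + _ = partial i (phi \* psi) x); last first.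
    by rewrite partialM//; congr (_ + _); rewrite mulrC.
  over.
rewrite integral_support => [|x Omx].
  rewrite (@integral_partial0 _ _ _ _ K)// => x /psi0 xK.
  by rewrite /= xK mulr0.
apply: (@partial_eq0 _ _ _ _ K) => // [y /psi0 /= ->|/KOm//].
by rewrite mulr0.
Qed.

Lemma L2P u : L2 Om u <->
  measurable_fun Om u /\ vol.-integrable Om (EFin \o (fun x => u x ^+ 2)).
Proof.
have E : (\int[vol]_(x in Om) (`|u x| ^+ 2)%:E =
          \int[vol]_(x in Om) `|(u x ^+ 2)%:E|)%E.
  by apply: eq_integral => x _; rewrite /= normrX.
split=> -[mu iu]; split => //; last by rewrite E; case/integrableP : iu.
apply/integrableP; split; last by rewrite -E.
by apply/measurable_EFinP; exact: measurable_funX.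
Qed.

Lemma L2_compact_support phi K : continuous phi -> compact K ->
  (forall x, ~ K x -> phi x = 0) -> L2 Om phi.
Proof.
move=> cphi cK phi0; apply/L2P; split; first exact: continuous_measurable_rV.
apply: (integrableS measurableT) => //.
apply: (@integrable_compact_support _ _ _ K) => //.
  move=> x; apply: (@continuous_comp _ _ _ phi (fun t => t ^+ 2)); first exact: cphi.
  exact: exprn_continuous.
by move=> x /phi0 ->; rewrite expr0n.
Qed.

Lemma test_function_H1 phi : test_function Om phi -> H1 Om phi.
Proof.
move=> tphi; have [cphi dphi cdphi [K [cK KOm phi0]]] := tphi.
split; first exact: L2_compact_support cphi cK phi0.
move=> i; exists (partial i phi); split; last exact: test_weak_partial.
apply: (L2_compact_support (cdphi i) cK) => x.
by apply: partial_eq0 phi0; exact: compact_closed.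
Qed.

(** The absolute value of [u] is at most 1 + u^2, and constants are integrable on a set of finite
    volume. *)
Lemma L2_integrable (A : set 'rV[R]_d) u : measurable A -> A `<=` Om ->
  (vol A < +oo)%E -> L2 Om u -> vol.-integrable A (EFin \o u).
Proof.
move=> mA AOm Aoo /L2P[mu iu].
apply: (@le_integrable _ _ _ _ _ mA _ (EFin \o (fun x => 1 + u x ^+ 2))).
- by apply/measurable_EFinP; exact: measurable_funS mu.
- move=> x _; rewrite /= lee_fin [leRHS]ger0_norm ?addr_ge0 ?sqr_ge0//.
  by rewrite ler_norml; apply/andP; split; nra.
apply: (@integrableD _ _ _ _ _ mA (EFin \o cst 1) (EFin \o (fun x => u x ^+ 2))).
  apply: measurable_bounded_integrable => //.
  by exists 1; split => [|y y1 x _]; [exact: num_real|rewrite /= normr1 ltW].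
exact: integrableS iu.
Qed.

Lemma L2N u : L2 Om u -> L2 Om (\- u).
Proof.
move=> [mu iu]; split; first exact: measurableT_comp.
by under eq_integral do rewrite /= normrN.
Qed.

Lemma L2B u v : L2 Om u -> L2 Om v -> L2 Om (u \- v).
Proof.
move=> /L2P[mu iu] /L2P[mv iv]; apply/L2P.
have muv : measurable_fun Om (u \- v) by exact: measurable_funB.
split => //.
apply: (@le_integrable _ _ _ _ _ mOm _
  (EFin \o (fun x => 2 * u x ^+ 2 + 2 * v x ^+ 2))).
- by apply/measurable_EFinP; exact: measurable_funX.
- move=> x _; rewrite /= lee_fin !ger0_norm ?sqr_ge0//.
    (* The right side minus the left side is exactly (u x + v x)^2. *)
    by have := sqr_ge0 (u x + v x); nra.
  by rewrite addr_ge0// mulr_ge0// sqr_ge0.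
apply: (@integrableD _ _ _ _ _ mOm (EFin \o (fun x => 2 * u x ^+ 2))
  (EFin \o (fun x => 2 * v x ^+ 2))).
  exact: (integrableZl mOm 2 iu).
exact: (integrableZl mOm 2 iv).
Qed.

Lemma bump_cvg (a b x : 'rV[R]_d) w :
  (w x * bump a b k x)%:E @[k --> \oo] --> ((EFin \o w) \_ (obox a b)) x.
Proof.
rewrite patchE; case: ifPn => [/set_mem abx|/negP abx].
  apply: cvg_near_cst; have := bump_near1 abx.
  by apply: filterS => k ->; rewrite mulr1.
apply: cvg_near_cst; apply: nearW => k.
by rewrite bump_eq0 ?mulr0// => /mem_set.
Qed.

(** Dominated convergence for [w] times the bump functions, on the closed box, where the absolute
    value of [w] is an integrable bound. *)
Lemma integral_obox0 w a b : L2 Om w ->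
  (forall psi, test_function Om psi -> \int[vol]_(x in Om) (w x * psi x) = 0) ->
  cbox a b `<=` Om -> (\int[vol]_(x in obox a b) (w x)%:E = 0)%E.
Proof.
move=> L2w w0 abOm; have mab := measurable_cbox a b.
have iw : vol.-integrable (cbox a b) (EFin \o w).
  by apply: L2_integrable => //; exact: vol_cbox_lty.
have mw := measurable_int _ iw.
have mbump k : measurable_fun (cbox a b) (bump a b k).
  by have [? _ _] := C1_bump a b k; exact: continuous_measurable_rV.
have [] := @dominated_convergence _ _ R vol _ mab
  (fun k x => (w x * bump a b k x)%:E) ((EFin \o w) \_ (obox a b))
  (fun x => `|(w x)%:E|)%E.
- move=> k; apply/measurable_EFinP; apply: measurable_funM => //.
  exact/measurable_EFinP.
- apply/measurable_restrict => //; first exact: measurable_obox.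
  by apply: measurable_funS mw => // x [].
- by apply: aeW => x _; exact: bump_cvg.
- exact: integrable_abse.
- apply: aeW => x k _; rewrite /= lee_fin normrM -[leRHS]mulr1.
  by rewrite ler_wpM2l// normr_bump_le1.
move=> _ _.
rewrite (_ : [sequence _]_k = cst 0%E); last first.
  apply/funext => k /=.
  have iwb : vol.-integrable (cbox a b) (EFin \o (fun x => w x * bump a b k x)).
    apply: (@le_integrable _ _ _ _ _ mab _ (EFin \o w)) => //.
      apply/measurable_EFinP; apply: measurable_funM => //.
      exact/measurable_EFinP.
    move=> x _; rewrite /= lee_fin normrM -[leRHS]mulr1.
    by rewrite ler_wpM2l// normr_bump_le1.
  have wb0 x : ~ cbox a b x -> w x * bump a b k x = 0.
    by move=> abx; rewrite bump_eq0 ?mulr0// => /obox_cbox.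
  have := w0 _ (test_function_bump k abOm).
  rewrite /Rintegral integral_support => [|x Omx]; last by rewrite wb0// => /abOm.
  rewrite -(integral_support wb0) => H.
  by rewrite -(fineK (integrable_fin_num mab iwb)) /= H.
rewrite -integral_mkcondr (setIidr (@obox_cbox _ _ a b)) => /cvg_lim <-//.
exact: lim_cst.
Qed.

(** The argument is local, as [w] is integrable on boxes of finite volume but possibly not on [Om].
    On each box its integral over every measurable subset vanishes. *)
Lemma fundamental_lemma w : L2 Om w ->
  (forall psi, test_function Om psi -> \int[vol]_(x in Om) (w x * psi x) = 0) ->
  {ae vol, forall x, Om x -> w x = 0}.
Proof.
move=> L2w w0.
have box0 a b : cbox a b `<=` Om -> {ae vol, forall x, obox a b x -> w x = 0}.
  move=> abOm; have mab := measurable_obox a b.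
  have iw : vol.-integrable (obox a b) (EFin \o w).
    apply: L2_integrable => //.
      exact: subset_trans (@obox_cbox _ _ _ _) abOm.
    apply: le_lt_trans (vol_cbox_lty a b).
    by apply: le_measure; rewrite ?inE//; [exact: measurable_cbox|exact: obox_cbox].
  suff /integral_ae_eq : forall E, E `<=` obox a b -> measurable E ->
      (\int[vol]_(x in E) (EFin \o w) x = \int[vol]_(x in E) (cst 0) x)%E.
    move=> /(_ mab iw (measurable_cst _)); apply: filterS => x wx abx.
    by case: (wx abx).
  (* The sets [E] with this property form a Dynkin system containing the open boxes, since the
     intersection of two boxes is a box. *)
  suff P E : measurable E -> (\int[vol]_(x in obox a b `&` E) (w x)%:E = 0)%E.
    by move=> E Eab mE; rewrite integral0 -(P E mE) (setIidr Eab).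
  rewrite measurable_oboxesE; move: E; apply: dynkin_induction.
  - exact: measurable_oboxesE.
  - exact: obox_setI.
  - by rewrite setIT; exact: integral_obox0.
  - move=> _ [a' [b' ->]].
    rewrite oboxI; apply: integral_obox0 => //.
    exact: subset_trans (@cboxI_sub _ _ _ _ _ _) abOm.
  - move=> S mS S0.
    have : (\int[vol]_(x in obox a b) (w x)%:E = 0)%E by exact: integral_obox0.
    have mabS : measurable (obox a b `&` S) by exact: measurableI.
    have mabSC : measurable (obox a b `&` ~` S).
      by apply: measurableI => //; exact: measurableC.
    have abE : obox a b = (obox a b `&` S) `|` (obox a b `&` ~` S).
      by rewrite -setIUr setUv setIT.
    rewrite [X in integral _ X]abE integral_setU//.
    + by rewrite S0 add0e.
    + by rewrite -abE; exact: measurable_int iw.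
    + by apply/disj_setPS => x [[_ Sx] []].
  - move=> F mF tF F0; rewrite setI_bigcupr integral_bigcup.
    + by apply: eseries0 => k _ _; exact: F0.
    + exact: trivIset_setIl.
    + by move=> k; exact: measurableI.
    + apply: integrableS iw => //; last by move=> x [k _ []].
      by apply: bigcupT_measurable => k; exact: measurableI.
(* Countably many boxes cover [Om], so the exceptional sets together are still null. *)
have [F [OmE FE]] := obox_cover oOm.
rewrite OmE; have /negligible_bigcup :
    forall k, vol.-negligible [set x | F k x /\ w x != 0].
  move=> k; case: (FE k) => [->|[a [b [-> /box0]]]].
    rewrite (_ : mkset _ = set0); first exact: negligible_set0.
    by apply/seteqP; split => x // [].
  apply: negligibleS => x /= [abx wx] H; move/eqP: wx; apply; exact: H.
apply: negligibleS => x /= /not_implyP[[k _ Fx] /eqP wx]; by exists k.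
Qed.

End weak_derivatives.

(** * Uniqueness of weak derivatives *)

Section weak_derivative_uniqueness.
Context {R : realType} {d : nat}.
Variable Om : set 'rV[R]_d.
Hypothesis oOm : open Om.
Implicit Types (u v psi phi : 'rV[R]_d -> R).

Local Notation vol := (lebesgue_rV R d).

Let mOm : measurable Om := open_measurable_rV oOm.

Lemma L2_mul_integrable u v : L2 Om u -> L2 Om v ->
  vol.-integrable Om (EFin \o (fun x => u x * v x)).
Proof.
move=> /L2P[mu iu] /L2P[mv iv].
apply: (@le_integrable _ _ _ _ _ mOm _ (EFin \o (fun x => u x ^+ 2 + v x ^+ 2))).
- by apply/measurable_EFinP; exact: measurable_funM.
- move=> x _; rewrite /= lee_fin [leRHS]ger0_norm ?addr_ge0 ?sqr_ge0//.
  by rewrite ler_norml; apply/andP; split; nra.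
exact: (integrableD mOm iu iv).
Qed.

Lemma weak_partial_unique (i : 'I_d) u v1 v2 : L2 Om v1 -> L2 Om v2 ->
  weak_partial Om i u v1 -> weak_partial Om i u v2 ->
  {ae vol, forall x, Om x -> v1 x = v2 x}.
Proof.
move=> L1 L2v w1 w2.
have /(fundamental_lemma oOm) : L2 Om (v1 \- v2) by exact: L2B.
have H psi : test_function Om psi -> \int[vol]_(x in Om) ((v1 \- v2) x * psi x) = 0.
  move=> tpsi; have L2psi : L2 Om psi by have [] := test_function_H1 oOm tpsi.
  under eq_Rintegral do rewrite /= mulrBl.
  rewrite RintegralB//; try exact: L2_mul_integrable.
  by apply/eqP; rewrite subr_eq0 -eqr_opp -(w1 _ tpsi) -(w2 _ tpsi).
by move=> /(_ H); apply: filterS => x v12 /v12 /= /eqP; rewrite subr_eq0 => /eqP.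
Qed.

Lemma wpartialP (i : 'I_d) u : H1 Om u ->
  L2 Om (wpartial Om i u) /\ weak_partial Om i u (wpartial Om i u).
Proof. by move=> [_ /(_ i)]; exact: getPex. Qed.

Lemma wpartial_ae (i : 'I_d) u v : H1 Om u -> L2 Om v -> weak_partial Om i u v ->
  {ae vol, forall x, Om x -> wpartial Om i u x = v x}.
Proof.
by move=> /(wpartialP i)[L2w w] L2v wv; exact: weak_partial_unique L2w L2v w wv.
Qed.

Lemma weak_partialN (i : 'I_d) u v :
  weak_partial Om i u v -> weak_partial Om i (\- u) (\- v).
Proof.
move=> uv psi /uv H.
under eq_Rintegral do rewrite mulNr.
under [in RHS]eq_Rintegral do rewrite mulNr.
by rewrite !RintegralN_nonmeasurable H.
Qed.

Lemma H1N u : H1 Om u -> H1 Om (\- u).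
Proof.
move=> [L2u du]; split=> [|i]; first exact: L2N.
have [v [L2v uv]] := du i; exists (\- v).
by split; [exact: L2N|exact: weak_partialN].
Qed.

Lemma wpartialN (i : 'I_d) u : H1 Om u ->
  {ae vol, forall x, Om x -> wpartial Om i (\- u) x = - wpartial Om i u x}.
Proof.
move=> H1u; have [L2v uv] := wpartialP i H1u.
by apply: wpartial_ae; [exact: H1N|exact: L2N|exact: weak_partialN].
Qed.

Lemma L2_cst0 : L2 Om (cst 0).
Proof.
split; first exact: measurable_cst.
by rewrite integral0_eq// => x _; rewrite /= normr0 expr0n.
Qed.

Lemma wpartial_eq0 (i : 'I_d) u : H1 Om u -> {ae vol, forall x, Om x -> u x = 0} ->
  {ae vol, forall x, Om x -> wpartial Om i u x = 0}.
Proof.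
move=> H1u u0; apply: (wpartial_ae H1u L2_cst0) => psi tpsi.
rewrite (ae_eq_Rintegral_nonmeasurable (g := cst 0)); last first.
  by apply: filterS u0 => x u0 /u0 ->; rewrite mul0r.
under [in RHS]eq_Rintegral do rewrite mul0r.
by rewrite /Rintegral integral0 oppr0.
Qed.

(** * Traces and nonzero elements of [H10] *)

Lemma hausdorff_nullS (s : nat) (A B : set 'rV[R]_d) :
  A `<=` B -> hausdorff_null s B -> hausdorff_null s A.
Proof.
move=> AB nB e e0; have [I [c [r [r0 Bcr rs]]]] := nB e e0.
by exists I, c, r; split => //; exact: subset_trans Bcr.
Qed.

Lemma H10N u : H10 Om u -> H10 Om (\- u).
Proof.
move=> [H1u tu]; split; first exact: H1N.
apply: hausdorff_nullS tu => x [bx nbv]; split => //; apply: contra_not nbv.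
move=> bv e /bv; apply: filterS => r.
rewrite (_ : (fun y => (`|(\- u) y - 0|)%:E) = (fun y => (`|u y - 0|)%:E))//.
by apply/funext => y; rewrite !subr0 normrN.
Qed.

(** Thus a Euclidean ball lies in the sup-norm ball of the same radius, the kind of ball that the
    topology uses. *)
Lemma coord_le_enorm (x : 'rV[R]_d) i : `|x ord0 i| <= enorm x.
Proof.
rewrite -sqrtr_sqr /enorm ler_wsqrtr// (bigD1 i)//= lerDl.
by apply: sumr_ge0 => j _; exact: sqr_ge0.
Qed.

Lemma test_function_H10 phi : test_function Om phi -> H10 Om phi.
Proof.
move=> tphi; split; first exact: test_function_H1.
have [_ _ _ [K [cK KOm phi0]]] := tphi.
(* As [Om] is open, a boundary point is outside [Om], hence outside the support [K], and [phi]
   vanishes on a whole ball around it. *)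
have bv x : bdry Om x -> boundary_value Om phi x 0.
  move=> [_ nOmx] e e0.
  have : open_nbhs x (~` K).
    split; last by move=> /KOm Omx; apply: nOmx; exact: open_nbhs_nbhs.
    by apply: closed_openC; exact: compact_closed.
  move=> /open_nbhs_nbhs; rewrite -nbhs_ballE => -[r /= r0 xrK].
  near=> s; rewrite integral0_eq.
    by apply: mule_ge0; [rewrite lee_fin ltW|exact: measure_ge0].
  move=> y [_ xsy]; rewrite phi0 ?subrr ?normr0//; apply: xrK.
  split => // i j; rewrite !ord1 /ball /= distrC.
  have -> : y ord0 j - x ord0 j = (y - x) ord0 j by rewrite !mxE.
  apply: le_lt_trans (coord_le_enorm _ _) _; apply: lt_le_trans xsy _.
  by near: s; exact: nbhs_right_le.
rewrite /has_trace /surface_ae (_ : mkset _ = set0); last first.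
  by apply/seteqP; split => // x [/bv].
(* No boundary point is exceptional; the empty cover, with sum 0, serves even when d - 1 = 0. *)
move=> e e0; exists set0, (fun=> 0), (fun=> 1).
by split => //; rewrite esum_set0 lte_fin.
Unshelve. all: by end_near.
Qed.

(** Already for k = 1 the bump function is positive on its whole open box, which has positive
    volume. *)
Lemma exists_nonzero_H10 : Om !=set0 -> exists2 phi, H10 Om phi & nonzero Om phi.
Proof.
move=> [x Omx]; have [F [OmE FE]] := obox_cover oOm.
have [k _ Fx] : (\bigcup_k F k) x by rewrite -OmE.
have [F0|[a [b [Fab abOm]]]] := FE k; first by rewrite F0 in Fx.
rewrite {}Fab {k FE F OmE} in Fx.
exists (bump a b 1); first exact/test_function_H10/test_function_bump.
move=> b0; have : vol.-negligible (obox a b).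
  apply: negligibleS b0 => y aby /= /(_ (abOm _ (obox_cbox aby))) /eqP.
  apply/negP; rewrite /bump prodf_seq_neq0; apply/allP => i _ /=.
  have := aby i; rewrite /= in_itv/= => /andP[ay yb].
  by rewrite mulf_neq0// gt_eqF// step_gt0// mul1r subr_gt0.
move=> /(measure_negligible (measurable_obox a b)) vab0.
suff : (0 < vol (obox a b))%E by rewrite vab0 ltxx.
rewrite vol_obox; elim/big_ind: _ => [|p q|i _]; [exact: lte01|exact: mule_gt0|].
have := Fx i; rewrite lebesgue_measure_itv/= in_itv/= => /andP[ax xb].
by rewrite lte_fin (lt_trans ax xb) -EFinD lte_fin subr_gt0 (lt_trans ax xb).
Qed.

Lemma nonzeroN phi : nonzero Om phi -> nonzero Om (\- phi).
Proof.
apply: contra_not; apply: filterS => x phi0 /phi0 /eqP.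
by rewrite oppr_eq0 => /eqP.
Qed.

Lemma L2normN phi : L2norm Om (\- phi) = L2norm Om phi.
Proof. by rewrite /L2norm; under eq_Rintegral do rewrite /= normrN. Qed.

Lemma L2norm_neq0 phi : L2 Om phi -> nonzero Om phi -> L2norm Om phi != 0.
Proof.
move=> [mphi phioo]; apply: contra_not_neq => /eqP.
rewrite /L2norm sqrtr_eq0 => int_le0.
have m2 : measurable_fun Om (fun x => (`|phi x| ^+ 2)%:E).
  by apply/measurable_EFinP; apply: measurable_funX; exact: measurableT_comp.
(* The real integral in [L2norm] turns an infinite value into 0; finiteness, from [L2], excludes
   this case. *)
have int0 : (\int[vol]_(x in Om) (`|phi x| ^+ 2)%:E = 0)%E.
  have ge0 : (0 <= \int[vol]_(x in Om) (`|phi x| ^+ 2)%:E)%E.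
    by apply: integral_ge0 => x _; rewrite lee_fin exprn_ge0.
  apply/eqP; rewrite eq_le ge0 andbT -[leLHS]fineK ?lee_fin//.
  by rewrite ge0_fin_numE.
have /(ae_eq_integral_abs _ mOm m2).1 :
    (\int[vol]_(x in Om) `|(`|phi x| ^+ 2)%:E| = 0)%E.
  rewrite -[RHS]int0; apply: eq_integral => x _.
  by rewrite gee0_abs// lee_fin exprn_ge0.
apply: filterS => x H /H [] /eqP.
by rewrite expf_eq0/= normr_eq0 => /eqP.
Qed.

End weak_derivative_uniqueness.

(** * The pairing and its operator norm *)

(** By symmetry the absolute value of each [q i] is itself a value of [q]. For an empty [P] the left
    side would be -oo and the right side +oo. *)
Lemma ereal_sup_sqr (R : realType) (I : Type) (P : set I) (q : I -> R) :
  P !=set0 -> (forall i, P i -> exists2 j, P j & q j = - q i) ->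
  ereal_sup [set (q i ^+ 2)%:E | i in P] =
  (ereal_sup [set (q i)%:E | i in P] ^+ 2)%E.
Proof.
move=> [i0 Pi0] symP; apply/eqP; rewrite eq_le; apply/andP; split.
  apply: ge_ereal_sup => _ [i Pi <-].
  have Pabs : (`|q i|%:E <= ereal_sup [set (q i)%:E | i in P])%E.
    apply: ereal_sup_ubound; have [qi|qi] := leP 0 (q i).
      by exists i => //; rewrite ger0_norm.
    by have [j Pj qj] := symP i Pi; exists j => //; rewrite qj ltr0_norm.
  rewrite -real_normK ?num_real// expr2 EFinM expe2.
  by apply: lee_pmul => //; rewrite lee_fin.
set M := (leRHS).
have qM i : P i -> ((q i ^+ 2)%:E <= M)%E.
  by move=> Pi; apply: ereal_sup_ubound; exists i.
have M0 : (0 <= M)%E by apply: (le_trans _ (qM _ Pi0)); rewrite lee_fin sqr_ge0.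
have m0 : (0 <= ereal_sup [set (q i)%:E | i in P])%E.
  have [q0|q0] := leP 0 (q i0).
    apply: (@le_trans _ _ (q i0)%:E); rewrite ?lee_fin//.
    by apply: ereal_sup_ubound; exists i0.
  have [j Pj qj] := symP i0 Pi0.
  apply: (@le_trans _ _ (q j)%:E); first by rewrite lee_fin qj oppr_ge0 ltW.
  by apply: ereal_sup_ubound; exists j.
(* An infinite supremum of squares bounds everything; a finite one, [s], bounds each [q i] by its
   square root. *)
case: M M0 qM => [s| |]// s0 qM; last by rewrite leey.
have sup_le : (ereal_sup [set (q i)%:E | i in P] <= (Num.sqrt s)%:E)%E.
  apply: ge_ereal_sup => _ [i Pi <-]; rewrite lee_fin.
  apply: le_trans (ler_norm _) _; rewrite -sqrtr_sqr ler_wsqrtr//.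
  by have := qM i Pi; rewrite lee_fin.
have -> : (s%:E = (Num.sqrt s)%:E * (Num.sqrt s)%:E)%E.
  by rewrite -EFinM -expr2 sqr_sqrtr.
by rewrite expe2; exact: lee_pmul.
Qed.

Section weak_formulation_theory.
Context {R : realType} {d : nat}.
Variables (Om : set 'rV[R]_d) (a : 'I_d -> 'I_d -> 'rV[R]_d -> R).
Variables (b : 'I_d -> 'rV[R]_d -> R) (c f : 'rV[R]_d -> R).
Hypotheses (oOm : open Om) (Om0 : Om !=set0).
Implicit Types (u phi : 'rV[R]_d -> R).

Local Notation vol := (lebesgue_rV R d).
Local Notation A := (pairing Om a b c f).

Lemma pairingN u phi : H1 Om phi -> A u (\- phi) = - A u phi.
Proof.
move=> H1phi; rewrite /pairing -RintegralN_nonmeasurable.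
apply: ae_eq_Rintegral_nonmeasurable.
have : {ae vol, forall x (i : 'I_d), Om x ->
    wpartial Om i (\- phi) x = - wpartial Om i phi x}.
  by apply: filter_forall => i; exact: wpartialN.
apply: filterS => x dphi Omx.
rewrite !opprD opprK; congr (_ + _ + _ + _).
- rewrite -sumrN; apply: eq_bigr => j _; rewrite -sumrN; apply: eq_bigr => i _.
  by rewrite dphi// mulrN.
- by rewrite -sumrN; apply: eq_bigr => i _; rewrite mulrN mulNr.
- by rewrite mulrN.
- by rewrite mulrN opprK.
Qed.

Lemma pairing_eq0 u phi : H1 Om phi -> ~ nonzero Om phi -> A u phi = 0.
Proof.
move=> H1phi /contrapT phi0; rewrite /pairing.
rewrite (ae_eq_Rintegral_nonmeasurable (g := cst 0)) /Rintegral ?integral0//.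
have dphi : {ae vol, forall x (i : 'I_d), Om x -> wpartial Om i phi x = 0}.
  by apply: filter_forall => i; exact: wpartial_eq0.
apply: filterS2 phi0 dphi => x phi0 dphi Omx; rewrite phi0//.
rewrite !mulr0 subr0 addr0 !big1 ?addr0// => [i _|j _].
  by rewrite mulr0 mul0r.
by rewrite big1// => i _; rewrite dphi// mulr0.
Qed.

Lemma max_quotientE u : max_quotient Om a b c f u = (opnorm Om a b c f u ^+ 2)%E.
Proof.
rewrite /opnorm -ereal_sup_sqr.
- congr ereal_sup; apply: eq_imagel => phi _.
  by rewrite expr_div_n real_normK ?num_real.
- have [phi Hphi nphi] := exists_nonzero_H10 oOm Om0; by exists phi.
move=> phi [Hphi nphi]; exists (\- phi).
  by split; [exact: H10N|exact: nonzeroN].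
by rewrite L2normN pairingN ?mulNr//; case: Hphi.
Qed.

Lemma opnorm_eq0 u :
  opnorm Om a b c f u = 0%E <-> forall phi, H10 Om phi -> A u phi = 0.
Proof.
split=> [u0 phi Hphi|u0].
  (* The supremum ranges only over nonzero [phi]; for the others the pairing vanishes anyway. For a
     nonzero [phi], the quotients of [phi] and of its opposite are both at most 0. *)
  have [nphi|] := pselect (nonzero Om phi); last first.
    by case: Hphi => H1phi _; exact: pairing_eq0.
  have le0 psi : H10 Om psi -> nonzero Om psi -> A u psi / L2norm Om psi <= 0.
    move=> Hpsi npsi; rewrite -lee_fin.
    apply: (@le_trans _ _ (opnorm Om a b c f u)); last by rewrite u0.
    by apply: ereal_sup_ubound; exists psi.
  have H1phi : H1 Om phi by case: Hphi.
  have L2phi : L2 Om phi by case: H1phi.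
  have := le0 _ (H10N Hphi) (nonzeroN nphi); have := le0 _ Hphi nphi.
  rewrite L2normN pairingN// mulNr oppr_le0 => q_le0 q_ge0.
  have /eqP : A u phi / L2norm Om phi = 0 by apply/eqP; rewrite eq_le q_le0.
  by rewrite mulf_eq0 invr_eq0 (negbTE (L2norm_neq0 oOm L2phi nphi)) orbF => /eqP.
(* All quotients are 0, and a nonzero element of [H10] ensures that there is at least one. *)
rewrite /opnorm (_ : [set _ | _ in _] = [set 0%E]) ?ereal_sup1//.
apply/seteqP; split => [_ [phi [Hphi _] <-]|_ ->] /=; first by rewrite u0// mul0r.
have [phi Hphi nphi] := exists_nonzero_H10 oOm Om0; exists phi => //.
by rewrite u0// mul0r.
Qed.

End weak_formulation_theory.

Theorem theorem1 (R : realType) (d : nat) (d_gt0 : (0 < d)%N)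
    (Om : set 'rV[R]_d) (Om_domain : domain Om)
    (a : 'I_d -> 'I_d -> 'rV[R]_d -> R) (b : 'I_d -> 'rV[R]_d -> R)
    (c f g : 'rV[R]_d -> R)
    (a_sym : forall i j x, Om x -> a i j x = a j i x)
    (theta : R) (theta_gt0 : 0 < theta)
    (a_elliptic : uniformly_elliptic Om a theta)
    (bc : boundary_condition) (ustar : 'rV[R]_d -> R)
    (ustar_bc : satisfies_bc Om g bc ustar) :
  (forall u : 'rV[R]_d -> R,
     minimizer Om (fun v => opnorm Om a b c f v ^+ 2)%E u <->
     minimizer Om (max_quotient Om a b c f) u) /\
  (weak_solution Om a b c f g bc ustar <->
   [/\ minimizer Om (fun v => opnorm Om a b c f v ^+ 2)%E ustar,
       minimizer Om (max_quotient Om a b c f) ustar &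
       opnorm Om a b c f ustar = 0%E]).
Proof.
have [oOm _ Om0] := Om_domain.
(* From here on the two minimization problems have the same objective. *)
have -> : max_quotient Om a b c f = (fun v => opnorm Om a b c f v ^+ 2)%E.
  by apply/funext => v; exact: max_quotientE.
split=> //; split=> [[H1u u0 _]|[[H1u _] _ /(opnorm_eq0 _ _ _ _ oOm Om0) u0]].
  have /(opnorm_eq0 _ _ _ _ oOm Om0) n0 := u0.
  have min : minimizer Om (fun v => opnorm Om a b c f v ^+ 2)%E ustar.
    (* A square in the extended reals is nonnegative, so the value 0 is minimal. *)
    by split=> // v _; rewrite n0 expe2 mul0e sqre_ge0.
  by split.
by split.
Qed.
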